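(* Let $a>0$, $\lambda>0$. The program $$\min_{\beta\in\Lambda,\ g\in[0,a\lambda]^d}\ \mathcal F_{\mathrm{MCP}}(\beta,g)$$ is equivalent to the quadratic program $$\min_{\beta,g,h\in\mathbb R^d}\ \tfrac12\Big(\beta^\top Q\beta+\frac na g^\top g-\frac{2n}{a}g^\top h\Big)+n\lambda\mathbf 1^\top h+q^\top\beta$$ $$\text{s.t.}\quad \beta\in\Lambda;\quad h\ge\beta;\quad h\ge-\beta;\quad 0\le g\le a\lambda,$$ i.e. $(\beta,g)$ is a global minimizer of the first program if and only if there exists $h\in\mathbb R^d$ such that $(\beta,g,h)$ is a global minimizer of the second program. (Vector inequalities are componentwise.)
   Context: Setting: $n\ge1$ is the sample size, $d\ge1$ the dimension, $0\le m<d$; $Q\in\mathbb R^{d\times d}$ is symmetric (not necessarily positive semidefinite), $q\in\mathbb R^d$, $\mathcal A\in\mathbb R^{d\times m}$ has full rank, $\mathbf b\in\mathbb R^m$, and $\Lambda:=\{\beta\in\mathbb R^d:\mathcal A^\top\beta\le\mathbf b\}$ is nonempty. $\mathbf 1$ is the all-ones vector. For $\beta,g\in\mathbb R^d$, $$\mathcal F_{\mathrm{MCP}}(\beta,g):=\tfrac12\beta^\top Q\beta+q^\top\beta+n\sum_{i=1}^d\Big\{\frac1{2a}g_i^2-\Big(\frac1ag_i-\lambda\Big)|\beta_i|\Big\}.$$ Standing assumption: the MCP penalized learning problem $\min_{\beta\in\Lambda}\tfrac12\beta^\top Q\beta+q^\top\beta+n\sum_{i=1}^dP_{\mathrm{MCP},\lambda}(|\beta_i|)$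 has a finite global solution, where $P_{\mathrm{MCP},\lambda}(\theta)=\int_0^\theta\frac{(a\lambda-t)_+}{a}\,dt$ for $\theta\ge0$ and $(b)_+=\max\{b,0\}$. *)

(* Defs.v *)
From HB Require Import structures.
From mathcomp Require Import all_boot all_order all_algebra.
From mathcomp Require Import all_classical all_reals all_analysis.

Set Implicit Arguments.
Unset Strict Implicit.
Unset Printing Implicit Defensive.

Import Order.TTheory GRing.Theory Num.Theory.
Import numFieldNormedType.Exports.

Local Open Scope classical_set_scope.
Local Open Scope ring_scope.

Definition global_minimizer (R : realType) (T : Type) (S : set T) (f : T -> R)
  (x : T) : Prop := S x /\ forall y, S y -> f x <= f y.

Definition vle (R : realType) (k : nat) (u v : 'cV[R]_k) : Prop :=
  forall i : 'I_k, u i 0 <= v i 0.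

(* Vectors are columns, so that u^T v is a 1 x 1 matrix, read off at (0, 0). *)
Definition dotcv (R : realType) (k : nat) (u v : 'cV[R]_k) : R :=
  (u^T *m v) 0 0.

Definition Lambda (R : realType) (d m : nat) (A : 'M[R]_(d, m)) (b : 'cV[R]_m)
  : set 'cV[R]_d := [set beta | vle (A^T *m beta) b].

Definition P_MCP (R : realType) (a lambda theta : R) : R :=
  \int[lebesgue_measure]_(t in `[0, theta]) (Num.max (a * lambda - t) 0 / a).

Definition MCP_objective (R : realType) (n d : nat) (Q : 'M[R]_d)
  (q : 'cV[R]_d) (a lambda : R) (beta : 'cV[R]_d) : R :=
  2^-1 * dotcv beta (Q *m beta) + dotcv q beta
  + n%:R * \sum_(i < d) P_MCP a lambda `|beta i 0|.

Definition F_MCP (R : realType) (n d : nat) (Q : 'M[R]_d) (q : 'cV[R]_d)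
  (a lambda : R) (beta g : 'cV[R]_d) : R :=
  2^-1 * dotcv beta (Q *m beta) + dotcv q beta
  + n%:R * \sum_(i < d) ((2 * a)^-1 * g i 0 ^+ 2
                         - (a^-1 * g i 0 - lambda) * `|beta i 0|).

Definition F_feasible (R : realType) (d m : nat) (A : 'M[R]_(d, m))
  (b : 'cV[R]_m) (a lambda : R) : set ('cV[R]_d * 'cV[R]_d) :=
  [set x | Lambda A b x.1 /\ vle 0 x.2 /\ vle x.2 (const_mx (a * lambda))].

Definition QP_objective (R : realType) (n d : nat) (Q : 'M[R]_d)
  (q : 'cV[R]_d) (a lambda : R) (beta g h : 'cV[R]_d) : R :=
  2^-1 * (dotcv beta (Q *m beta) + n%:R / a * dotcv g g
          - 2 * n%:R / a * dotcv g h)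
  + n%:R * lambda * dotcv (const_mx 1) h + dotcv q beta.

Definition QP_feasible (R : realType) (d m : nat) (A : 'M[R]_(d, m))
  (b : 'cV[R]_m) (a lambda : R) : set ('cV[R]_d * 'cV[R]_d * 'cV[R]_d) :=
  [set x | [/\ Lambda A b x.1.1, vle x.1.1 x.2, vle (- x.1.1) x.2,
               vle 0 x.1.2 & vle x.1.2 (const_mx (a * lambda))]].

(* Main.v *)
Require Import Defs.
From HB Require Import structures.
From mathcomp Require Import all_boot all_order all_algebra.
From mathcomp Require Import all_classical all_reals all_analysis.
From mathcomp Require Import ring.

(** The quadratic program is the first program with every [`|beta i 0|]
    replaced by a slack [h i 0] that only has to satisfy
    [h i 0 >= `|beta i 0|].  The coefficient of [h i 0] in the objective is
    [n (lambda - g i 0 / a)], which the bound [g i 0 <= a lambda] makes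
    nonnegative; hence over the feasible slacks the objective is smallest at
    [h = |beta|], where it equals [F_MCP] ([F_MCP_le_QP_objective],
    [QP_objective_absmx]).  So [F_MCP] is the partial minimum of the quadratic
    objective over [h], and this minimum is attained: that is what carries
    global minimizers back and forth.  When [g i 0 = a lambda] the coefficient
    vanishes and [h i 0] is not determined, so only the existence of [h] can be
    claimed. *)

Set Implicit Arguments.
Unset Strict Implicit.
Unset Printing Implicit Defensive.

Import Order.TTheory GRing.Theory Num.Theory.
Import numFieldNormedType.Exports.

Local Open Scope classical_set_scope.
Local Open Scope ring_scope.

Lemma dotcvE (R : realType) (k : nat) (u v : 'cV[R]_k) :
  dotcv u v = \sum_(i < k) u i 0 * v i 0.
Proof. by rewrite /dotcv mxE; apply: eq_bigr => i _; rewrite mxE. Qed.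

Section SlackReformulation.
Variables (R : realType) (n d : nat) (Q : 'M[R]_d) (q : 'cV[R]_d).
Variables (a lambda : R).
Hypothesis a_gt0 : 0 < a.
Implicit Types beta g h : 'cV[R]_d.

Let absmx beta : 'cV[R]_d := map_mx Num.norm beta.

(** This is the shape of [F_MCP], so that the two objectives can be compared
    coordinate by coordinate. *)
Lemma QP_objectiveE beta g h :
  QP_objective n Q q a lambda beta g h =
  2^-1 * dotcv beta (Q *m beta) + dotcv q beta
  + n%:R * \sum_(i < d) ((2 * a)^-1 * g i 0 ^+ 2
                         - (a^-1 * g i 0 - lambda) * h i 0).
Proof.
have sumE : \sum_(i < d) ((2 * a)^-1 * g i 0 ^+ 2
                          - (a^-1 * g i 0 - lambda) * h i 0) =
    (2 * a)^-1 * dotcv g g - a^-1 * dotcv g h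
    + lambda * dotcv (const_mx 1) h.
  rewrite !dotcvE !mulr_sumr -sumrB -big_split /=.
  by apply: eq_bigr => i _; rewrite mxE; ring.
rewrite sumE /QP_objective; field.
by rewrite gt_eqF.
Qed.

Lemma QP_objective_absmx beta g :
  QP_objective n Q q a lambda beta g (absmx beta) =
  F_MCP n Q q a lambda beta g.
Proof.
rewrite QP_objectiveE /F_MCP; congr (_ + _ * _).
by apply: eq_bigr => i _; rewrite mxE.
Qed.

(** The upper bound on [g] makes the objective nondecreasing in each [h i 0],
    and the two constraints on [h] say that [h i 0 >= `|beta i 0|]. *)
Lemma F_MCP_le_QP_objective beta g h :
  vle g (const_mx (a * lambda)) -> vle beta h -> vle (- beta) h ->
  F_MCP n Q q a lambda beta g <= QP_objective n Q q a lambda beta g h.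
Proof.
move=> g_le beta_le Nbeta_le; rewrite QP_objectiveE /F_MCP lerD2l.
apply: ler_wpM2l => //; apply: ler_sum => i _; rewrite lerD2l lerN2.
apply: ler_wnM2l.
  by rewrite subr_le0 ler_pdivrMl //; have := g_le i; rewrite mxE.
by rewrite ler_norml lerNl beta_le; have := Nbeta_le i; rewrite mxE => ->.
Qed.

Lemma QP_feasible_absmx m (A : 'M[R]_(d, m)) (b : 'cV[R]_m) beta g :
  F_feasible A b a lambda (beta, g) ->
  QP_feasible A b a lambda (beta, g, absmx beta).
Proof.
case=> /= betaL [g_ge0 g_le]; split=> //= i; rewrite !mxE ?ler_norm //.
by rewrite -normrN ler_norm.
Qed.

End SlackReformulation.

Theorem corollary2p4 (R : realType) (n d m : nat)
  (Q : 'M[R]_d) (q : 'cV[R]_d) (A : 'M[R]_(d, m)) (b : 'cV[R]_m)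
  (a lambda : R)
  (n_ge1 : (1 <= n)%N) (d_ge1 : (1 <= d)%N) (lt_md : (m < d)%N)
  (Q_sym : Q^T = Q) (A_full_rank : \rank A = m) (Lambda_neq0 : Lambda A b !=set0)
  (a_gt0 : 0 < a) (lambda_gt0 : 0 < lambda)
  (MCP_solvable : exists beta : 'cV[R]_d,
     global_minimizer (Lambda A b) (MCP_objective n Q q a lambda) beta)
  (beta g : 'cV[R]_d) :
  global_minimizer (F_feasible A b a lambda)
    (fun x => F_MCP n Q q a lambda x.1 x.2) (beta, g)
  <-> exists h : 'cV[R]_d,
      global_minimizer (QP_feasible A b a lambda)
        (fun x => QP_objective n Q q a lambda x.1.1 x.1.2 x.2) (beta, g, h).
Proof.
split=> [[feas minF]|[h [[/= betaL beta_le Nbeta_le g_ge0 g_le] minQP]]].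
  exists (map_mx Num.norm beta); split; first exact: QP_feasible_absmx.
  move=> [[beta' g'] h'] [/= betaL' beta_le' Nbeta_le' g_ge0' g_le'].
  rewrite QP_objective_absmx //; apply: (le_trans (minF (beta', g') _)) => //=.
  exact: F_MCP_le_QP_objective.
split=> // -[beta' g'] /= feas'.
apply: (le_trans (F_MCP_le_QP_objective n Q q a_gt0 g_le beta_le Nbeta_le)).
rewrite -(QP_objective_absmx n Q q _ a_gt0 beta').
exact: minQP (QP_feasible_absmx feas').
Qed.
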